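(* Let $J:=\operatorname{conv}\{\mathbf{v}_0,\mathbf{v}_1,\dots,\mathbf{v}_d\}\subset\mathbb{R}^d_{\ge 0}\setminus\{\mathbf{0}\}$ be a $d$-simplex, and suppose $f(\mathbf{0})=0$ and $f$ is continuous and convex on $\operatorname{conv}(J\cup\{\mathbf{0}\})$. Then $$\operatorname{vol}(P^0(f,J))=\frac{1}{(d+2)!}\left|\det\begin{bmatrix}\mathbf{v}_0&\mathbf{v}_1&\dots&\mathbf{v}_d\\ 1&1&\dots&1\end{bmatrix}\right|\sum_{j=0}^d f(\mathbf{v}_j)-\int_0^1 z^d\int_J f(z\mathbf{x})\,d\mathbf{x}\,dz.$$
   Context: Let $\mu:\mathbb{R}^d\to\mathbb{R}$ be the unique affine function agreeing with $f$ at the vertices of $J$, and let $\mu(\mathbf{x},z):=z\,\mu(\mathbf{x}/z)$ (which extends to a linear function of $(\mathbf{x},z)$, e.g. $\mu(\mathbf{x},z)=\mathbf{w}^\top\mathbf{B}^{-1}(\mathbf{x}-z\mathbf{v}_0)+f(\mathbf{v}_0)z$ with $\mathbf{B}=[\mathbf{v}_1-\mathbf{v}_0,\dots,\mathbf{v}_d-\mathbf{v}_0]$, $\mathbf{w}_j=f(\mathbf{v}_j)-f(\mathbf{v}_0)$). For $z\ge0$, $z\cdot J:=\{z\mathbf{x}:\mathbf{x}\in J\}$. The naive relaxation is $$P^0(f,J):=\{(\mathbf{x},y,z)\in\mathbb{R}^d\times\mathbb{R}\times\mathbb{R}:\ \mu(\mathbf{x},z)\ge y\ge f(\mathbf{x}),\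 \mathbf{x}\in z\cdot J,\ 1\ge z\ge 0\}.$$ $\operatorname{vol}$ denotes $(d+2)$-dimensional Lebesgue measure. *)

(* Defs.v *)
From HB Require Import structures.
From mathcomp Require Import all_boot all_order all_algebra.
From mathcomp Require Import all_classical all_reals all_analysis.
Set Implicit Arguments. Unset Strict Implicit. Unset Printing Implicit Defensive.
Import Order.TTheory GRing.Theory Num.Theory.
Import numFieldNormedType.Exports.
Local Open Scope classical_set_scope.
Local Open Scope ring_scope.

Definition convhull (R : realType) (n : nat) (S : set 'rV[R]_n) : set 'rV[R]_n :=
  [set x | exists (m : nat) (p : 'I_m -> 'rV[R]_n) (l : 'I_m -> R),
     [/\ (forall i, S (p i)), (forall i, 0 <= l i), \sum_(i < m) l i = 1
       & x = \sum_(i < m) l i *: p i]].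

Definition dil (R : realType) (n : nat) (z : R) (J : set 'rV[R]_n) : set 'rV[R]_n :=
  [set y | exists2 x, J x & y = z *: x].

Definition convex_on (R : realType) (n : nat) (K : set 'rV[R]_n) (f : 'rV[R]_n -> R) :=
  forall x y t, K x -> K y -> 0 <= t <= 1 ->
    f ((1 - t) *: x + t *: y) <= (1 - t) * f x + t * f y.

(* Iterated Lebesgue integral over R^n of an extended-real valued function
   (first coordinate integrated outermost).  This is how the n-dimensional
   Lebesgue integral / measure is realised (Fubini-Tonelli). *)
Fixpoint iint (R : realType) (n : nat) : ('rV[R]_n -> \bar R) -> \bar R :=
  match n return ('rV[R]_n -> \bar R) -> \bar R with
  | 0 => fun F => F 0
  | n'.+1 => fun F =>
      (\int[@lebesgue_measure R]_(t in [set: R])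
          iint (fun x : 'rV[R]_n' => F (row_mx (t%:M : 'M[R]_1) x)))%E
  end.

Definition voln (R : realType) (n : nat) (A : set 'rV[R]_n) : \bar R :=
  iint (fun x => (\1_A x)%:E).

Definition intn (R : realType) (n : nat) (D : set 'rV[R]_n) (g : 'rV[R]_n -> R) : \bar R :=
  iint (fun x => ((g \_ D) x)%:E).

Definition simplex (R : realType) (d : nat) (v : 'I_d.+1 -> 'rV[R]_d) : set 'rV[R]_d :=
  convhull (range v).

Definition Bmat (R : realType) (d : nat) (v : 'I_d.+1 -> 'rV[R]_d) : 'M[R]_d :=
  \matrix_(i < d, j < d) (v (lift ord0 j) - v ord0) 0 i.

Definition wvec (R : realType) (d : nat) (v : 'I_d.+1 -> 'rV[R]_d)
  (f : 'rV[R]_d -> R) : 'rV[R]_d :=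
  \row_(j < d) (f (v (lift ord0 j)) - f (v ord0)).

Definition muhom (R : realType) (d : nat) (v : 'I_d.+1 -> 'rV[R]_d)
  (f : 'rV[R]_d -> R) (x : 'rV[R]_d) (z : R) : R :=
  (wvec v f *m invmx (Bmat v) *m (x - z *: v ord0)^T) 0 0 + f (v ord0) * z.

Definition ord_y : 'I_2 := ord0.
Definition ord_z : 'I_2 := ord_max.

(* The naive relaxation P^0(f, J) as a subset of R^(d+2), a point being
   (x, y, z) packed as row_mx x (row_mx y z). *)
Definition P0 (R : realType) (d : nat) (v : 'I_d.+1 -> 'rV[R]_d)
  (f : 'rV[R]_d -> R) : set 'rV[R]_(d + 2) :=
  [set p : 'rV[R]_(d + 2) | let x : 'rV[R]_d := lsubmx p in
           let y : R := (rsubmx p : 'rV[R]_2) 0 ord_y in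
           let z : R := (rsubmx p : 'rV[R]_2) 0 ord_z in
           [/\ muhom v f x z >= y, y >= f x, dil z (simplex v) x & 0 <= z <= 1]].

Definition Vmat (R : realType) (d : nat) (v : 'I_d.+1 -> 'rV[R]_d) : 'M[R]_d.+1 :=
  \matrix_(i < d.+1, j < d.+1)
     (if unlift ord_max i is Some k then v j 0 k else 1).

(* Main.v *)
(** Integrating over y first and z last turns vol(P^0) into the integral of
    (mu(x, z) - f(x)) over the cone C of all (z, x) with 0 <= z <= 1 and
    x in z.J; the integrand is nonnegative there because f 0 = 0 and f is
    convex.  In the coordinates lam given by (z, x) = sum_j lam_j (1, v_j), a
    linear change of variables of determinant det [v; 1] up to sign, C is the
    standard (d+1)-simplex and mu is sum_j lam_j f(v_j); each lam_j has
    integral 1/(d+2)! over that simplex.  The f-part is the substitution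
    x -> z x in each slice.

    The iterated integral [iint] is identified with integration against a
    measure [rVleb n] on ['rV_n], so that Tonelli and Fubini apply. *)
Require Import Defs.
From HB Require Import structures.
From mathcomp Require Import all_boot all_order all_algebra.
From mathcomp Require Import fingroup perm.
From mathcomp Require Import all_classical all_reals all_analysis.
From mathcomp Require Import measurable_realfun ring lra.
Set Implicit Arguments. Unset Strict Implicit. Unset Printing Implicit Defensive.
Import Order.TTheory GRing.Theory Num.Theory.
Import numFieldNormedType.Exports.
Local Open Scope classical_set_scope.
Local Open Scope ring_scope.

(** * Lebesgue measure on row vectors *)

(** For nonnegative integrands, such as mu - f cut off to the cone, measurability is enough to
    exchange integrals, and the volume is first reduced to a single integral over R^(d+1) in that
    form. Splitting this integral into its mu-part and its f-part is the delicate point: f may be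
    negative, so integrability is required, and on every slice. Hence the class [box_bounded] of
    bounded measurable functions vanishing off a box, and a two-sided bound for f on the cone,
    obtained from convexity. The height z comes first in R^(d+1), so that fixing the outermost
    variable gives the slice z.J; the coordinates of P^0 are ordered x, y, z instead, which costs
    one exchange of y with z and one of x with z. As f is constrained only on the hull of J and 0,
    both integrands are multiplied by the indicator of the cone. *)

Definition rV_display : measure_display. Proof. exact: default_measure_display. Qed.

Section rV_measurable.
Context {R : realType} (n : nat).

Definition rV_cylinders : set (set 'rV[R]_n) :=
  [set A | exists (i : 'I_n) (B : set R),
    measurable B /\ A = (fun x : 'rV[R]_n => x 0 i) @^-1` B].

Let m0 : <<s rV_cylinders >> set0.
Proof. exact: sigma_algebra0. Qed.
Let mC A : <<s rV_cylinders >> A -> <<s rV_cylinders >> (~` A).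
Proof. exact: sigma_algebraC. Qed.
Let mU (F : (set 'rV[R]_n)^nat) : (forall i, <<s rV_cylinders >> (F i)) ->
  <<s rV_cylinders >> (\bigcup_i (F i)).
Proof. exact: sigma_algebra_bigcup. Qed.

HB.instance Definition _ :=
  @isMeasurable.Build rV_display 'rV[R]_n <<s rV_cylinders >> m0 mC mU.

Lemma measurable_coord (i : 'I_n) :
  measurable_fun [set: 'rV[R]_n] (fun x : 'rV[R]_n => x 0 i).
Proof.
by move=> _ B mB; rewrite setTI; apply: sub_sigma_algebra; exists i, B.
Qed.

Lemma measurable_rVP d (T : measurableType d) (f : T -> 'rV[R]_n) :
  (forall i, measurable_fun setT (fun t => f t 0 i)) -> measurable_fun setT f.
Proof.
move=> mf; apply: (@measurability _ _ _ _ _ _ rV_cylinders) => //.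
by move=> _ [_ [i [B [mB ->]]] <-]; apply: mf.
Qed.

(** Each point of an open set lies in a box with rational centre and radius 1/(k+1) that is
    contained in the set, and there are only countably many such boxes. This is the link between
    continuity of f and the product sigma-algebra. *)
Lemma open_measurable_rV (U : set 'rV[R]_n) : open U -> measurable U.
Proof.
move=> oU.
pose box (q : 'rV[rat]_n * nat) : set 'rV[R]_n :=
  [set x | forall i, `|ratr (q.1 0 i) - x 0 i| < q.2.+1%:R^-1].
pose F (q : 'rV[rat]_n * nat) := if `[< box q `<=` U >] then box q else set0.
have -> : U = \bigcup_q F q.
  apply/seteqP; split=> [x Ux|x [q _]]; last first.
    by rewrite /F; case: asboolP => // + bx; exact.
  have /nbhs_ballP[e /= e0 eU] : nbhs x U by exact: open_nbhs_nbhs.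
  (* Two moves shorter than 1/(k+1), from x to the rational centre and from there to y, have to stay
     below e. *)
  have [k ke] : exists k, (k.+1%:R : R)^-1 < e / 2.
    have [k _ /(_ k (leqnn k)) /= ?] :=
      near_infty_natSinv_lt (PosNum (divr_gt0 e0 (ltr0Sn R 1))).
    by exists k.
  have /choice[q hq] : forall i : 'I_n, exists q : rat,
      `|ratr q - x 0 i| < (k.+1%:R : R)^-1.
    move=> i; have /rat_in_itvoo[q] : x 0 i < x 0 i + k.+1%:R^-1 by rewrite ltrDl invr_gt0.
    rewrite in_itv/= => /andP[q1 q2]; exists q; rewrite ger0_norm ?subr_ge0 1?ltW//.
    by rewrite ltrBlDl.
  exists (\row_i q i, k) => //; rewrite /F; case: asboolP => [_ i|]; first by rewrite mxE.
  case=> y by_; apply: eU; split=> // i j; rewrite [i]ord1 /ball /=.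
  have := by_ j; have := hq j; rewrite /= mxE => h1 h2.
  rewrite (_ : _ - _ = (ratr (q j) - y 0 j) - (ratr (q j) - x 0 j)); last by ring.
  by rewrite (le_lt_trans (ler_normB _ _))// (splitr e) ltrD// (lt_trans _ ke).
apply: countable_bigcupT_measurable; first exact: countableP.
move=> q; rewrite /F; case: ifP => // _.
have -> : box q = \bigcap_(i in [set: 'I_n]) ((fun x : 'rV[R]_n => x 0 i) @^-1`
    (ball (ratr (q.1 0 i) : R) (q.2.+1%:R^-1))).
  by apply/seteqP; split=> [x bx i _|x bx i]; [exact: bx|exact: (bx i I)].
apply: fin_bigcap_measurable => //.
move=> i _; rewrite -[X in measurable X]setTI; apply: measurable_coord => //.
exact: measurable_ball.
Qed.

End rV_measurable.

Section rV_lebesgue.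
Context {R : realType}.
Local Open Scope ereal_scope.
Local Notation mR := (measurableTypeR R).

Definition consr n (p : mR * 'rV[R]_n) : 'rV[R]_n.+1 := row_mx (p.1%:M : 'M[R]_1) p.2.

Lemma consr0 n (p : mR * 'rV[R]_n) : consr p 0%R ord0 = p.1.
Proof.
have -> : @ord0 n = lshift n (ord0 : 'I_1) by apply: val_inj.
by apply: etrans (row_mxEl _ _ _ _) _; rewrite mxE eqxx.
Qed.

Lemma consrS n (p : mR * 'rV[R]_n) i : consr p 0%R (lift ord0 i) = p.2 0%R i.
Proof.
have -> : lift (@ord0 n) i = rshift 1 i by apply: val_inj.
exact: row_mxEr.
Qed.

Lemma measurable_consr n : measurable_fun [set: mR * 'rV[R]_n] (@consr n).
Proof.
apply: measurable_rVP => i; case: (unliftP ord0 i) => [j ->|->].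
  under eq_fun do rewrite consrS.
  exact: (measurableT_comp (measurable_coord j)).
under eq_fun do rewrite consr0.
exact: measurable_fst.
Qed.

Section step.
Variables (n : nat) (m : {sigma_finite_measure set 'rV[R]_n -> \bar R}).

Definition consm (A : set 'rV[R]_n.+1) : \bar R :=
  (@lebesgue_measure R \x m) (@consr n @^-1` A).

Let mconsr (A : set 'rV[R]_n.+1) : measurable A -> measurable (@consr n @^-1` A).
Proof. by move=> mA; rewrite -[X in measurable X]setTI; exact: measurable_consr. Qed.

Let consm0 : consm set0 = 0. Proof. by rewrite /consm preimage_set0 measure0. Qed.
Let consm_ge0 A : 0 <= consm A. Proof. exact: measure_ge0. Qed.
Let consm_sigma_additive : semi_sigma_additive consm.
Proof.
move=> F mF tF mUF; rewrite /consm preimage_bigcup.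
apply: measure_semi_sigma_additive.
- by move=> k; exact: mconsr.
- apply/trivIsetP => i j _ _ ij; rewrite -preimage_setI.
  by move/trivIsetP : tF => ->//; rewrite preimage_set0.
- by rewrite -preimage_bigcup; exact: mconsr.
Qed.
HB.instance Definition _ := isMeasure.Build _ _ _ consm
  consm0 consm_ge0 consm_sigma_additive.

Definition unconsr (x : 'rV[R]_n.+1) : mR * 'rV[R]_n :=
  (x 0%R ord0, \row_i x 0%R (lift ord0 i)).

Lemma consrK : cancel (@consr n) unconsr.
Proof.
case=> t x; rewrite /unconsr consr0; congr pair.
by apply/rowP => i; rewrite mxE consrS.
Qed.

Lemma measurable_unconsr : measurable_fun setT unconsr.
Proof.
apply: measurable_fun_pair; first exact: measurable_coord.
apply: measurable_rVP => i; under eq_fun do rewrite mxE; exact: measurable_coord.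
Qed.

Let sf : sigma_finite setT consm.
Proof.
have /sigma_finiteP[F [FT ndF Ffin]] := sigma_finiteT (@lebesgue_measure R).
have /sigma_finiteP[G [GT ndG Gfin]] := sigma_finiteT m.
exists (fun i => unconsr @^-1` (F i `*` G i)).
  apply/seteqP; split=> // x _.
  have [i _ Fx] : (\bigcup_i F i) (unconsr x).1 by rewrite -FT.
  have [j _ Gx] : (\bigcup_i G i) (unconsr x).2 by rewrite -GT.
  (* Both exhaustions are nondecreasing, so the products of sets with equal index already cover. *)
  exists (maxn i j) => //; split.
    by move/subsetPset : (ndF _ _ (leq_maxl i j)); exact.
  by move/subsetPset : (ndG _ _ (leq_maxr i j)); exact.
move=> i; have [mF Foo] := Ffin i; have [mG Goo] := Gfin i; split.
  by rewrite -[X in measurable X]setTI; apply: measurable_unconsr => //; exact: measurableX.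
rewrite /consm (_ : _ @^-1` _ = F i `*` G i).
  by rewrite product_measure1E// lte_mul_pinfty// ge0_fin_numE.
by apply/predeqP => x; rewrite /preimage /mkset consrK.
Qed.
HB.instance Definition _ := Measure_isSigmaFinite.Build _ _ _ consm sf.

End step.

(** Sigma-finiteness is carried along because the next product requires it. In dimension 0 the only
    vector has mass 1, matching the base case of [iint]. *)
Fixpoint rVleb n : {sigma_finite_measure set 'rV[R]_n -> \bar R} :=
  match n with
  | 0 => @dirac _ 'rV[R]_0 0%R R
  | n'.+1 => consm (rVleb n')
  end.

Lemma ge0_integral_rVlebS n (F : 'rV[R]_n.+1 -> \bar R) :
  measurable_fun setT F -> (forall x, 0 <= F x) ->
  \int[rVleb n.+1]_x F x = \int[@lebesgue_measure R \x rVleb n]_p F (consr p).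
Proof.
move=> mF F0.
rewrite -[RHS](ge0_integral_pushforward (@measurable_consr n)
  (@lebesgue_measure R \x rVleb n) (D := setT))//.
Qed.
End rV_lebesgue.

(** * Iterated integrals as integrals against [rVleb] *)

Section rVleb_integral.
Context {R : realType}.
Local Open Scope ereal_scope.
Local Notation mR := (measurableTypeR R).
Local Notation leb := (@lebesgue_measure R).

Lemma measurable_consr_slice n d (T : measurableType d) (F : 'rV[R]_n.+1 -> T) (t : R) :
  measurable_fun setT F -> measurable_fun setT (fun x => F (consr (t, x))).
Proof.
move=> mF; apply: (measurableT_comp mF).
exact: (measurableT_comp (@measurable_consr R n) (measurable_pair1 t)).
Qed.

Lemma ge0_integral_rVleb_consr n (F : 'rV[R]_n.+1 -> \bar R) :
  measurable_fun setT F -> (forall x, 0 <= F x) ->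
  \int[rVleb n.+1]_x F x = \int[leb]_t \int[rVleb n]_x F (consr (t, x)).
Proof.
move=> mF F0; rewrite ge0_integral_rVlebS// fubini_tonelli1//.
exact: (measurableT_comp mF (@measurable_consr R n)).
Qed.

Lemma ge0_iintE n (F : 'rV[R]_n -> \bar R) :
  measurable_fun setT F -> (forall x, 0 <= F x) ->
  iint F = \int[rVleb n]_x F x.
Proof.
elim: n F => [|n IH] F mF F0.
  by rewrite /= integral_dirac// diracT mul1e.
rewrite ge0_integral_rVleb_consr//=; apply: eq_integral => t _; apply: IH => //.
exact: measurable_consr_slice.
Qed.

Definition rVbox n (C : R) : set 'rV[R]_n := [set x | forall i, (`|x 0 i| <= C)%R].

Lemma measurable_rVbox n (C : R) : measurable (@rVbox n C).
Proof.
have -> : @rVbox n C = \bigcap_(i in [set: 'I_n])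
    ((fun x : 'rV[R]_n => x 0%R i) @^-1` [set t | (`|t| <= C)%R]).
  by apply/seteqP; split=> [x bx i _|x bx i]; [exact: bx|exact: (bx i I)].
apply: fin_bigcap_measurable => // i _.
rewrite -[X in measurable X]setTI; apply: measurable_coord => //.
have -> : [set t : R | (`|t| <= C)%R] = `[(- C)%R, C]%classic.
  by apply/seteqP; split=> t /=; rewrite in_itv/= ler_norml.
exact: measurable_itv.
Qed.

Lemma rVleb_rVbox n (C : R) : rVleb n (@rVbox n C) < +oo.
Proof.
elim: n => [|n IH].
  by rewrite /= /dirac ltry.
rewrite [rVleb _ _]/(consm (rVleb n) _) /consm.
have -> : @consr R n @^-1` (@rVbox n.+1 C) = `[(- C)%R, C]%classic `*` @rVbox n C.
  apply/seteqP; split=> [[t x]|[t x]] /=.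
    move=> h; split=> [|i]; first by have := h ord0; rewrite consr0/= in_itv/= ler_norml.
    by have := h (lift ord0 i); rewrite consrS.
  rewrite in_itv/= -ler_norml => -[ht hx] i; case: (unliftP ord0 i) => [j ->|->].
    by rewrite consrS; exact: hx.
  by rewrite consr0.
rewrite product_measure1E//; last exact: measurable_rVbox.
apply: lte_mul_pinfty => //.
rewrite ge0_fin_numE//; have := @lebesgue_measure_itv R `[(- C)%R, C] => /= ->.
by case: ifP => // _; rewrite -EFinD ltry.
Qed.

(** A class of signed integrands closed under fixing the first coordinate, so that Fubini can be
    repeated at every level; plain integrability would pass only to almost every slice. One constant
    serves as bound and as size of the box. *)
Definition box_bounded n (F : 'rV[R]_n -> R) :=
  measurable_fun setT F /\ exists C : R, forall x, (`|F x| <= C)%R /\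
    (F x != 0%R -> rVbox C x).

Lemma box_bounded_integrable n (F : 'rV[R]_n -> R) :
  box_bounded F -> (rVleb n).-integrable setT (EFin \o F).
Proof.
move=> [mF [C hF]].
have C0 : (0 <= C)%R by apply: le_trans (hF 0%R).1.
apply: (@le_integrable _ _ _ _ _ _ _ (fun x => C%:E * (\1_(rVbox C) x)%:E)) => //.
- exact/measurable_EFinP.
- move=> x _ /=; rewrite lee_fin indicE.
  have [->|Fx] := eqVneq (F x) 0%R; first by rewrite normr0.
  by have [h1 /(_ Fx) h2] := hF x; rewrite mem_set//= mulr1 (ger0_norm C0).
- apply: integrableZl => //; apply/integrableP; split.
    by apply/measurable_EFinP; apply: measurable_indic; exact: measurable_rVbox.
  under eq_integral do rewrite /= ger0_norm//.
  by rewrite integral_indic ?setIT//; [exact: rVleb_rVbox|exact: measurable_rVbox].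
Qed.

Lemma box_bounded_slice n (F : 'rV[R]_n.+1 -> R) (t : R) :
  box_bounded F -> box_bounded (fun x => F (consr (t, x))).
Proof.
move=> [mF [C hF]]; split; first exact: measurable_consr_slice.
exists C => x; have [h1 h2] := hF (consr (t, x)); split=> // /h2 h i.
by have := h (lift ord0 i); rewrite consrS.
Qed.

Lemma box_bounded_iintE n (F : 'rV[R]_n -> R) :
  box_bounded F -> iint (EFin \o F) = \int[rVleb n]_x (F x)%:E.
Proof.
elim: n F => [|n IH] F bF.
  by rewrite /= integral_dirac ?diracT ?mul1e//; apply/measurable_EFinP; case: bF.
have mFc : measurable_fun setT (EFin \o F \o @consr R n).
  by apply: (measurableT_comp _ (@measurable_consr R n)); apply/measurable_EFinP; case: bF.
have iFc : (leb \x rVleb n).-integrable setT (EFin \o F \o @consr R n).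
  apply/integrableP; split => //.
  have /integrableP[_] := box_bounded_integrable bF.
  rewrite ge0_integral_rVlebS//.
  by apply: measurableT_comp => //; apply/measurable_EFinP; case: bF.
transitivity (\int[leb]_t \int[rVleb n]_x (F (consr (t, x)))%:E).
  by rewrite /=; apply: eq_integral => t _; apply: IH; exact: box_bounded_slice.
rewrite (integral12_prod_meas1 iFc).
have mF : measurable_fun setT (EFin \o F) by apply/measurable_EFinP; case: bF.
have := integral_pushforward (@measurable_consr R n) (D := setT) mF iFc measurableT.
by rewrite preimage_setT => <-.
Qed.

Lemma measurable_mulmx n m (A : 'M[R]_(n, m)) :
  measurable_fun setT (fun x : 'rV[R]_n => x *m A).
Proof.
apply: measurable_rVP => j; under eq_fun do rewrite mxE.
apply: measurable_sum => k; apply: measurable_funM => //; exact: measurable_coord.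
Qed.

Lemma measurable_addmx n (b : 'rV[R]_n) :
  measurable_fun setT (fun x : 'rV[R]_n => (b + x)%R).
Proof.
apply: measurable_rVP => j; under eq_fun do rewrite mxE.
by apply: measurable_funD => //; exact: measurable_coord.
Qed.

End rVleb_integral.

(** * Affine substitution on the line *)

Section affine_line.
Context {R : realType}.
Local Open Scope ereal_scope.
Local Notation leb := (@lebesgue_measure R).
Local Notation mR := (measurableTypeR R).

Variables (a b : R).
Hypothesis a0 : a != 0%R.
Let phi (t : mR) : mR := (a * t + b)%R.

Let mphi : measurable_fun [set: mR] phi.
Proof. by apply: measurable_funD => //; apply: measurable_funM. Qed.

Let push : {measure set mR -> \bar R} :=
  measure_function_pushforward__canonical__measure_function_Measure leb mphi.

(** By uniqueness of Lebesgue measure it suffices to compare on intervals []c, e]]. A negative slope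
    turns the preimage into an interval closed on the left, of the same length. *)
Lemma lebesgue_measure_affine (A : set mR) :
  measurable A -> leb A = `|a|%:E * leb (phi @^-1` A).
Proof.
move=> mA.
have := @lebesgue_measure_unique R (mscale (NngNum (normr_ge0 a)) push) _ A mA.
rewrite /mscale/= => -> // X [[c e] _ <-].
rewrite lebesgue_measure_itv /mscale /= /pushforward.
have [a_gt0|a_le0] := ltP 0%R a.
  have -> : phi @^-1` `]c, e]%classic = `]((c - b) / a)%R, ((e - b) / a)%R]%classic.
    apply/seteqP; split=> t /=; rewrite !in_itv/= /phi => /andP[h1 h2]; apply/andP; split;
    move: h1 h2; rewrite ?ltr_pdivrMr// ?ler_pdivlMr//; lra.
  rewrite lebesgue_measure_itv/= !lte_fin ltr_pM2r ?invr_gt0// ltrD2r.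
  case: ifP => _; last by rewrite mule0.
  by rewrite -!EFinB -EFinM gtr0_norm//; congr EFin; field.
have a_lt0 : (a < 0)%R by rewrite lt_neqAle a0.
have -> : phi @^-1` `]c, e]%classic = `[((e - b) / a)%R, ((c - b) / a)%R[%classic.
  apply/seteqP; split=> t /=; rewrite !in_itv/= /phi => /andP[h1 h2]; apply/andP; split;
  move: h1 h2; rewrite ?ltr_ndivlMr// ?ler_ndivrMr//; lra.
rewrite lebesgue_measure_itv/= !lte_fin ltr_nM2r ?invr_lt0// ltrD2r.
case: ifP => _; last by rewrite mule0.
by rewrite -!EFinB -EFinM ltr0_norm//; congr EFin; field.
Qed.

Lemma ge0_integral_affine (F : mR -> \bar R) :
  measurable_fun setT F -> (forall t, 0 <= F t) ->
  \int[leb]_t F t = `|a|%:E * \int[leb]_t F (a * t + b)%R.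
Proof.
move=> mF F0.
transitivity (\int[mscale (NngNum (normr_ge0 a)) push]_t F t).
  by apply: eq_measure_integral => A mA _; exact: lebesgue_measure_affine.
rewrite ge0_integral_mscale//=; congr (_ * _).
exact: ge0_integral_pushforward.
Qed.

End affine_line.

(** * Linear change of variables *)

Section change_of_variables.
Context {R : realType}.
Local Open Scope ereal_scope.
Local Notation mR := (measurableTypeR R).
Local Notation leb := (@lebesgue_measure R).

Lemma addr_consr n (b : 'rV[R]_n.+1) (t : R) (x : 'rV[R]_n) :
  (b + consr (t, x) = consr (t + b 0%R ord0, (unconsr b).2 + x))%R.
Proof.
apply/rowP => i; rewrite mxE; case: (unliftP ord0 i) => [j ->|->].
  by rewrite !consrS !mxE.
by rewrite !consr0 addrC.
Qed.

Lemma measurable_integral_consr n (F : 'rV[R]_n.+1 -> \bar R) :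
  measurable_fun setT F -> (forall x, 0 <= F x) ->
  measurable_fun setT (fun t : mR => \int[rVleb n]_x F (consr (t, x))).
Proof.
move=> mF F0.
have mFc := measurableT_comp mF (@measurable_consr R n).
exact: (measurable_fun_fubini_tonelli_F (m2 := rVleb n) _ mFc (fun _ => F0 _)).
Qed.

Lemma ge0_integral_rVleb_translate n (b : 'rV[R]_n) (F : 'rV[R]_n -> \bar R) :
  measurable_fun setT F -> (forall x, 0 <= F x) ->
  \int[rVleb n]_x F (b + x)%R = \int[rVleb n]_x F x.
Proof.
elim: n b F => [|n IH] b F mF F0.
  by apply: eq_integral => x _; rewrite (thinmx0 (b + x)%R) (thinmx0 x).
rewrite !ge0_integral_rVleb_consr//; last exact: measurableT_comp mF (measurable_addmx _).
under eq_integral => t _.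
  under eq_integral do rewrite addr_consr.
  rewrite (IH (unconsr b).2 (fun y => F (consr ((t + b 0%R ord0)%R, y))))//;
    last exact: measurable_consr_slice.
  over.
rewrite (ge0_integral_affine (b 0%R ord0) (oner_neq0 R)
  (measurable_integral_consr mF F0)); last first.
  by move=> t; exact: integral_ge0.
rewrite normr1 mul1e; apply: eq_integral => t _.
by rewrite mul1r.
Qed.

(** A predicate on matrices, so that the substitution rule can be carried along products of
    block-triangular factors. *)
Definition scales_volume n (A : 'M[R]_n) := forall F : 'rV[R]_n -> \bar R,
  measurable_fun setT F -> (forall x, 0 <= F x) ->
  \int[rVleb n]_x F x = `|\det A|%:E * \int[rVleb n]_x F (x *m A).

Lemma scales_volumeM n (A B : 'M[R]_n) :
  scales_volume A -> scales_volume B -> scales_volume (A *m B).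
Proof.
move=> hA hB F mF F0; rewrite hB// hA//; last first.
  exact: measurableT_comp mF (measurable_mulmx B).
rewrite det_mulmx normrM EFinM muleCA muleA; congr (_ * _).
by apply: eq_integral => x _; rewrite mulmxA.
Qed.

Lemma scales_volume1 n : scales_volume (1%:M : 'M[R]_n).
Proof.
by move=> F _ _; rewrite det1 normr1 mul1e; under [RHS]eq_integral do rewrite mulmx1.
Qed.

Lemma consr_mul_block n (a : R) (b : 'rV[R]_n) (c : 'cV[R]_n) (D : 'M[R]_n) (t : R) x :
  consr (t, x) *m (block_mx a%:M b c D : 'M[R]_(1 + n)) =
  consr (a * t + (x *m c) 0%R 0%R, t *: b + x *m D)%R.
Proof.
rewrite /consr /= (mul_row_block (t%:M : 'M[R]_1) x (a%:M : 'M[R]_1) b c D).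
congr row_mx; last by rewrite mul_scalar_mx.
by rewrite -scalar_mxM raddfD /= -mx11_scalar mulrC.
Qed.

(** With the first coordinate fixed at t, the tail undergoes [D] followed by the translation
    [t *: b], which is harmless; the first coordinate itself is only scaled by [a]. *)
Lemma scales_volume_ublock n (a : R) (b : 'rV[R]_n) (D : 'M[R]_n) :
  a != 0%R -> scales_volume D ->
  scales_volume (block_mx a%:M b 0 D : 'M[R]_(1 + n)).
Proof.
move=> a0 hD F mF F0.
have mFA : measurable_fun setT (fun x : 'rV[R]_n.+1 =>
    F (x *m (block_mx a%:M b 0 D : 'M[R]_(1 + n)))).
  exact: measurableT_comp mF (measurable_mulmx _).
rewrite !ge0_integral_rVleb_consr// det_ublock det_scalar1 normrM EFinM -muleA.
rewrite -ge0_integralZl//; last 2 first.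
- exact: measurable_integral_consr mFA _.
- by move=> t _; exact: integral_ge0.
rewrite (ge0_integral_affine 0 a0 (measurable_integral_consr mF F0)); last first.
  by move=> t; exact: integral_ge0.
congr (_ * _); apply: eq_integral => t _.
have mFt s : measurable_fun setT (fun y => F (consr (s, y))).
  exact: measurable_consr_slice.
rewrite -(ge0_integral_rVleb_translate (t *: b) (mFt _))// hD//; last first.
  by apply: measurableT_comp (mFt _) (measurable_addmx _).
congr (_ * _); apply: eq_integral => x _.
by rewrite consr_mul_block mulmx0 mxE.
Qed.

(** The tail stays put and the first coordinate is shifted by an amount depending on the tail.
    Tonelli moves the first coordinate innermost, where that shift is a constant. *)
Lemma scales_volume_lblock n (c : 'cV[R]_n) :
  scales_volume (block_mx 1%:M 0 c 1%:M : 'M[R]_(1 + n)).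
Proof.
move=> F mF F0.
have mFA : measurable_fun setT (fun x : 'rV[R]_n.+1 =>
    F (x *m (block_mx 1%:M 0 c 1%:M : 'M[R]_(1 + n)))).
  exact: measurableT_comp mF (measurable_mulmx _).
rewrite !ge0_integral_rVleb_consr// det_lblock !det1 mulr1 normr1 mul1e.
have mFc := measurableT_comp mF (@measurable_consr R n).
have mFAc := measurableT_comp mFA (@measurable_consr R n).
rewrite (fubini_tonelli (F \o @consr R n) mFc (fun _ => F0 _)).

rewrite (fubini_tonelli _ mFAc (fun _ => F0 _)).
apply: eq_integral => x _.
have mFx : measurable_fun setT (fun t : mR => F (consr (t, x))).
  exact: (measurableT_comp mFc (measurable_pair2 x)).
rewrite (ge0_integral_affine ((x *m c) 0%R 0%R) (oner_neq0 R) mFx)//.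
rewrite normr1 mul1e; apply: eq_integral => t _ /=.
by rewrite consr_mul_block scaler0 add0r mulmx1.
Qed.

(* A vanishing pivot is repaired by adding a row to the top one, which is
   block-triangular, so permutation matrices never have to be treated. *)
Lemma scales_volume_unitmx n (A : 'M[R]_n) : A \in unitmx -> scales_volume A.
Proof.
elim: n A => [|n IH] A uA.
  move=> F _ _; rewrite det_mx00 normr1 mul1e; apply: eq_integral => x _.
  by rewrite (thinmx0 (_ *m _)) (thinmx0 x).
have pivot (B : 'M[R]_(1 + n)) : B \in unitmx -> B 0%R 0%R != 0%R -> scales_volume B.
  move=> uB; set a := B 0%R 0%R => a0.
  have ulB : ulsubmx B = a%:M.
    by rewrite [LHS]mx11_scalar !mxE; congr (B _ _)%:M; apply: val_inj.
  (* The Schur complement of the pivot, from block elimination; it is invertible because [B] is. *)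
  pose D := (drsubmx B - a^-1 *: (dlsubmx B *m ursubmx B))%R.
  have BE : B = (block_mx 1%:M 0 (a^-1 *: dlsubmx B) 1%:M : 'M[R]_(1 + n)) *m
      block_mx a%:M (ursubmx B) 0 D.
    rewrite mulmx_block !mul1mx !mul0mx !addr0 mul_mx_scalar scalerA mulfV// scale1r.
    by rewrite -scalemxAl /D addrC subrK -ulB submxK.
  rewrite BE; apply: scales_volumeM; first exact: scales_volume_lblock.
  apply: scales_volume_ublock => //; apply: IH.
  move: uB; rewrite BE !unitmxE det_mulmx det_lblock !det1 !mul1r det_ublock.
  by rewrite unitrM => /andP[].
have [i Ai] : exists i, A i 0%R != 0%R.
  apply: contrapT => /forallNP h; move: uA.
  rewrite unitmxE (expand_det_col A 0%R) big1 ?unitr0// => i _.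
  by have /negP := h i; rewrite negbK => /eqP ->; rewrite mul0r.
case: (unliftP ord0 i) Ai => [k ->|->] Ai; last exact: pivot.
have [A00|] := eqVneq (A 0%R 0%R) 0%R; last exact: pivot.
pose e : 'rV[R]_n := delta_mx 0%R k.
pose U (b : 'rV[R]_n) : 'M[R]_(1 + n) := block_mx 1%:M b 0 1%:M.
have UU : U (- e)%R *m U e = 1%:M.
  rewrite mulmx_block !mul1mx !mul0mx !mulmx0 !mulmx1 !addr0 add0r subrr.
  by rewrite -scalar_mx_block.
have uU b : U b \in unitmx by rewrite unitmxE det_ublock !det1 mulr1 unitr1.
have -> : A = U (- e)%R *m (U e *m (A : 'M[R]_(1 + n))) by rewrite mulmxA UU mul1mx.
apply: scales_volumeM.
  by apply: scales_volume_ublock; [exact: oner_neq0|exact: scales_volume1].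
apply: pivot; first by rewrite unitmx_mul uU.
have Ue j : U e 0%R (lift ord0 j) = (j == k)%:R%R.
  have -> : 0%R = lshift n (0%R : 'I_1) by apply: val_inj.
  have -> : lift ord0 j = rshift 1 j by apply: val_inj.
  by rewrite /U block_mxEur mxE eqxx.
rewrite mxE big_ord_recl A00 mulr0 add0r (bigD1 k)//= Ue eqxx mul1r.
rewrite big1 ?addr0// => j /negbTE jk.
by rewrite Ue jk mul0r.
Qed.
End change_of_variables.

(** * Integrals over the standard simplex *)

Section iint_computations.
Context {R : realType}.
Local Open Scope ereal_scope.
Local Notation mR := (measurableTypeR R).
Local Notation leb := (@lebesgue_measure R).

Lemma ge0_integral_rVleb_mulmx n (A : 'M[R]_n) (F : 'rV[R]_n -> \bar R) :
  A \in unitmx -> measurable_fun setT F -> (forall x, 0 <= F x) ->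
  \int[rVleb n]_x F (x *m A) = (`|\det A|^-1)%:E * \int[rVleb n]_x F x.
Proof.
move=> uA mF F0; rewrite (scales_volume_unitmx uA mF F0) muleA -EFinM mulVf ?mul1e//.
by rewrite normr_eq0 -unitfE -unitmxE.
Qed.

Lemma integral_rVleb_mulmx n (A : 'M[R]_n) (F : 'rV[R]_n -> \bar R) :
  A \in unitmx -> (rVleb n).-integrable setT F ->
  \int[rVleb n]_x F (x *m A) = (`|\det A|^-1)%:E * \int[rVleb n]_x F x.
Proof.
move=> uA iF; have mF : measurable_fun setT F by case/integrableP : iF.
rewrite integralE [in RHS]integralE muleBr//; last exact: integrable_add_def.
congr (_ - _).
  rewrite -(ge0_integral_rVleb_mulmx uA (measurable_funepos mF))//.
  by rewrite (funepos_comp F (fun x => x *m A)).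
rewrite -(ge0_integral_rVleb_mulmx uA (measurable_funeneg mF))//.
by rewrite (funeneg_comp F (fun x => x *m A)).
Qed.

Lemma eq_iint n (F G : 'rV[R]_n -> \bar R) : F =1 G -> iint F = iint G.
Proof. by move=> /funext ->. Qed.

Lemma iint0 n : iint (fun _ : 'rV[R]_n => 0 : \bar R) = 0.
Proof. by elim: n => [//|n IH] /=; under eq_integral do rewrite IH; rewrite integral0. Qed.

(** No measurability is assumed: the nested integrals are regrouped, never exchanged. *)
Lemma iint_row_mx m n (F : 'rV[R]_(m + n) -> \bar R) :
  iint F = iint (fun x : 'rV[R]_m => iint (fun y : 'rV[R]_n => F (row_mx x y))).
Proof.
elim: m F => [|m IH] F.
  by rewrite /=; apply: eq_iint => y; rewrite row_thin_mx.
apply: eq_integral => t _.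
apply: etrans (IH (fun w => F (row_mx (t%:M : 'M[R]_1) w))) _.
apply: eq_iint => x; apply: eq_iint => y.
by rewrite row_mxA castmx_id.
Qed.

Lemma integral_itv_deriv_poly (P : {poly R}) (a b : R) : (a <= b)%R ->
  \int[leb]_(t in `[a, b]) (P^`().[t])%:E = (P.[b] - P.[a])%:E.
Proof.
rewrite le_eqVlt => /predU1P[->|ab].
  by rewrite set_itv1 integral_set1 subrr.
rewrite (@continuous_FTC2 _ _ (horner P))//.
- by apply: continuous_subspaceT => x; exact: continuous_horner.
- split.
  + by move=> x _; exact: derivable_horner.
  + by apply: cvg_at_right_filter; exact: continuous_horner.
  + by apply: cvg_at_left_filter; exact: continuous_horner.
- by move=> x _; rewrite derivE.
Qed.

Let hornerS :=
  (hornerZ, horner_exp, hornerM, hornerD, hornerN, hornerC, hornerX).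

Lemma deriv_subX_exp (s : R) k :
  ((s%:P - 'X) ^+ k.+1)^`() = (- k.+1%:R) *: (s%:P - 'X) ^+ k :> {poly R}.
Proof.
by rewrite deriv_exp derivB derivC derivX sub0r mulN1r scaleNr scaler_nat mulNrn.
Qed.

(** The size [s] is a parameter for the sake of induction: fixing the first coordinate at t leaves a
    simplex of size s - t. *)
Definition std_simplex n (s : R) : set 'rV[R]_n :=
  [set x | (forall i, 0 <= x 0 i)%R /\ (\sum_i x 0 i <= s)%R].

Lemma measurable_std_simplex n (s : R) : measurable (@std_simplex n s).
Proof.
have -> : @std_simplex n s =
    (\bigcap_(i in [set: 'I_n]) ((fun x : 'rV[R]_n => x 0%R i) @^-1` `[0%R, +oo[)) `&`
    ((fun x : 'rV[R]_n => \sum_i x 0 i)%R @^-1` `]-oo, s]).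
  apply/seteqP; split=> x; rewrite /std_simplex /= in_itv/=.
    by move=> [h1 h2]; split=> // i _ /=; rewrite in_itv/= h1.
  by move=> [h1 h2]; split=> // i; have := h1 i I; rewrite /= in_itv/= andbT.
apply: measurableI.
  apply: fin_bigcap_measurable => // i _.
  by rewrite -[X in measurable X]setTI; apply: measurable_coord => //; exact: measurable_itv.
rewrite -[X in measurable X]setTI.
have ms : measurable_fun setT (fun x : 'rV[R]_n => \sum_i x 0 i)%R.
  by apply: measurable_sum => i; exact: measurable_coord.
by apply: ms => //; exact: measurable_itv.
Qed.

Lemma std_simplex_consr n (s t : R) (x : 'rV[R]_n) :
  std_simplex s (consr (t, x)) <-> (0 <= t)%R /\ std_simplex (s - t) x.
Proof.
rewrite /std_simplex /= big_ord_recl consr0/=.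
under eq_bigr do rewrite consrS/=.
rewrite -lerBrDl; split=> [[h1 h2]|[h0 [h1 h2]]].
  split; first by have := h1 ord0; rewrite consr0.
  by split=> // i; have := h1 (lift ord0 i); rewrite consrS.
by split=> // i; case: (unliftP ord0 i) => [j ->|->]; rewrite ?consrS ?consr0//=.
Qed.

Lemma std_simplex_ge0 n (s : R) (x : 'rV[R]_n) : std_simplex s x -> (0 <= s)%R.
Proof. by move=> [h1]; apply: le_trans; apply: sumr_ge0. Qed.

Lemma iint_std_simplex_consr n (s : R) (g : 'rV[R]_n.+1 -> R) :
  iint (fun x => (g x * \1_(std_simplex s) x)%:E) =
  \int[leb]_(t in `[0%R, s])
    iint (fun x => (g (consr (t, x)) * \1_(std_simplex (s - t)) x)%:E).
Proof.
rewrite [RHS]integral_mkcond /=; apply: eq_integral => t _.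
rewrite patchE; case: ifPn => ts.
  apply: eq_iint => x; congr (_ * _)%:E; rewrite !indicE; congr (nat_of_bool _)%:R.
  move: ts; rewrite inE/= in_itv/= => /andP[t0 _].
  apply/idP/idP; rewrite !inE; first by move=> /std_simplex_consr[].
  by move=> h; apply/std_simplex_consr.
rewrite -[RHS](iint0 n); apply: eq_iint => x; rewrite indicE memNset ?mulr0//.
move=> /std_simplex_consr[t0 /std_simplex_ge0]; rewrite subr_ge0 => st.
by move: ts; rewrite notin_setE/= in_itv/= t0 st.
Qed.

Lemma iint_std_simplex n (s : R) : (0 <= s)%R ->
  iint (fun x : 'rV[R]_n => (\1_(std_simplex s) x)%:E) = (s ^+ n / n`!%:R)%:E.
Proof.
elim: n s => [|n IH] s s0.
  rewrite /= indicE mem_set ?expr0 ?fact0 ?divr1//; split=> [[]//|].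
  by rewrite big_ord0.
under eq_iint do rewrite -[X in X%:E]mul1r.
rewrite (iint_std_simplex_consr s (fun=> 1%R)).
(* The primitive of the slice volume (s - t)^n / n! that vanishes at t = s. *)
pose P : {poly R} := (- (n.+1`!%:R^-1)) *: (s%:P - 'X) ^+ n.+1.
have dP t : P^`().[t] = ((s - t) ^+ n / n`!%:R)%R.
  rewrite /P derivZ deriv_subX_exp !hornerS factS natrM.
  field.
  by rewrite pnatr_eq0 -lt0n fact_gt0/= nat1r pnatr_eq0.
under eq_integral => t.
  rewrite inE/= in_itv/= => /andP[t0 ts].
  under eq_iint do rewrite mul1r.
  rewrite IH ?subr_ge0// -dP; over.
rewrite integral_itv_deriv_poly// /P !hornerS subrr expr0n/= subr0.
by congr EFin; ring.
Qed.

(** If [j] is not the first coordinate, the induction hypothesis evaluates each slice. If it is, the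
    slice contributes t times its volume, and integration by parts gives the same value. *)
Lemma iint_std_simplex_coord n (s : R) (j : 'I_n) : (0 <= s)%R ->
  iint (fun x : 'rV[R]_n => (x 0 j * \1_(std_simplex s) x)%:E) =
  (s ^+ n.+1 / n.+1`!%:R)%:E.
Proof.
elim: n s j => [|n IH] s j s0; first by case: j.
have f0 k : (k`!%:R != 0 :> R)%R by rewrite pnatr_eq0 -lt0n fact_gt0.
have k0 k : (k.+1%:R != 0 :> R)%R by rewrite pnatr_eq0.
(* A scalar is taken out of the nested integrals by passing to [rVleb] and back. *)
have iintZ (t u : R) : (0 <= t)%R ->
    iint (fun x : 'rV[R]_n => t%:E * (\1_(std_simplex u) x)%:E) =
    t%:E * iint (fun x : 'rV[R]_n => (\1_(std_simplex u) x)%:E).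
  move=> t0.
  have mT : measurable_fun setT (fun x : 'rV[R]_n => (\1_(std_simplex u) x : R)%:E).
    by apply/measurable_EFinP; apply: measurable_indic; exact: measurable_std_simplex.
  rewrite (ge0_iintE mT)// ge0_iintE; first by rewrite ge0_integralZl.
    exact: measurable_funeM.
  by move=> x; rewrite mule_ge0.
rewrite (iint_std_simplex_consr s (fun x => x 0%R j)).
case: (unliftP ord0 j) => [k|] ->.
  pose P : {poly R} := (- (n.+2`!%:R^-1)) *: (s%:P - 'X) ^+ n.+2.
  have dP t : P^`().[t] = ((s - t) ^+ n.+1 / n.+1`!%:R)%R.
    rewrite /P derivZ deriv_subX_exp !hornerS [in LHS]factS natrM.
    rewrite invfM; set u := (n.+1`!%:R^-1)%R; field.
    by rewrite ?k0.
  under eq_integral => t.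
    rewrite inE/= in_itv/= => /andP[t0 ts].
    under eq_iint do rewrite consrS/=.
    rewrite IH ?subr_ge0// -dP; over.
  rewrite integral_itv_deriv_poly// /P !hornerS subrr expr0n/= subr0.
  by congr EFin; ring.
(* A primitive of t (s - t)^n / n!, found by parts; only its second term survives at t = 0, and both
   vanish at t = s. *)
pose P : {poly R} := ((- (n.+1`!%:R^-1)) *: ('X * (s%:P - 'X) ^+ n.+1)
   - (n.+2`!%:R^-1) *: (s%:P - 'X) ^+ n.+2)%R.
have dP t : P^`().[t] = (t * ((s - t) ^+ n / n`!%:R))%R.
  rewrite /P derivB !derivZ derivM derivX !deriv_subX_exp !hornerS.
  rewrite [in LHS]factS [in LHS]factS !natrM exprS; field.
  by rewrite f0 nat1r k0 -natrD k0.
under eq_integral => t.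
  rewrite inE/= in_itv/= => /andP[t0 ts].
  under eq_iint do rewrite consr0/= EFinM.
  rewrite iintZ//.
  rewrite iint_std_simplex ?subr_ge0// -EFinM -dP; over.
rewrite integral_itv_deriv_poly// /P !hornerS subrr !expr0n/= subr0.
by congr EFin; ring.
Qed.

End iint_computations.

(** * Cones over simplices *)

Section convexity.
Context {R : realType} (d : nat).
Variables (S : set 'rV[R]_d) (f : 'rV[R]_d -> R).
Hypotheses (S0 : S 0) (f0 : f 0 = 0) (cf : convex_on (convhull S) f).

(** The missing weight [1 - \sum_i l i] is put on the point 0 of [S]. *)
Lemma convhull_subconvex n (p : 'I_n -> 'rV[R]_d) (l : 'I_n -> R) :
  (forall i, S (p i)) -> (forall i, 0 <= l i) -> \sum_i l i <= 1 ->
  convhull S (\sum_i l i *: p i).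
Proof.
move=> Sp l0 l1.
exists n.+1, (fun i => if unlift ord0 i is Some k then p k else 0),
  (fun i => if unlift ord0 i is Some k then l k else 1 - \sum_i l i).
split.
- by move=> i; case: (unlift _ _).
- by move=> i; case: (unlift _ _) => //; rewrite subr_ge0.
- rewrite big_ord_recl unlift_none.
  by under [X in _ + X]eq_bigr do rewrite liftK; rewrite subrK.
- rewrite big_ord_recl unlift_none scaler0 add0r.
  by under [RHS]eq_bigr do rewrite liftK.
Qed.

(** Jensen's inequality with total weight at most 1; the missing weight sits at 0 and costs nothing
    because f 0 = 0. The first point is split off and the others, rescaled by [c], again have total
    weight at most 1. *)
Lemma convex_on_subconvex n (p : 'I_n -> 'rV[R]_d) (l : 'I_n -> R) :
  (forall i, S (p i)) -> (forall i, 0 <= l i) -> \sum_i l i <= 1 ->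
  f (\sum_i l i *: p i) <= \sum_i l i * f (p i).
Proof.
elim: n p l => [|n IH] p l Sp l0 l1; first by rewrite !big_ord0 f0.
move: l1; rewrite !big_ord_recl => l1.
have s0 : 0 <= \sum_(i < n) l (lift ord0 i) by exact: sumr_ge0.
(* Here the rescaling factor would be 0; all the other weights vanish. *)
have [l01|l01] := eqVneq (l ord0) 1.
  have h i : l (lift ord0 i) = 0.
    have /psumr_eq0P : \sum_(i < n) l (lift ord0 i) = 0.
      by apply/le_anti; rewrite s0 andbT; lra.
    by apply.
  rewrite !big1 ?l01 ?addr0 ?scale1r ?mul1r//.
    by move=> i _; rewrite h mul0r.
  by move=> i _; rewrite h scale0r.
pose c := 1 - l ord0.
have c1 : c <= 1 by rewrite /c lerBlDr lerDl.
have c0 : 0 < c.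
  by rewrite /c subr_gt0 lt_neqAle l01 (le_trans _ l1)// lerDl.
pose y := \sum_(i < n) (l (lift ord0 i) / c) *: p (lift ord0 i).
have yl0 (i : 'I_n) : 0 <= l (lift ord0 i) / c by rewrite divr_ge0// ltW.
have yl1 : \sum_(i < n) l (lift ord0 i) / c <= 1.
  by rewrite -mulr_suml ler_pdivrMr// mul1r /c lerBrDl.
have Ky : convhull S y by exact: convhull_subconvex.
have Kp : convhull S (p ord0).
  have := @convhull_subconvex 1 (fun=> p ord0) (fun=> 1).
  by rewrite !big_ord1 scale1r; apply.
have -> : \sum_(i < n) l (lift ord0 i) *: p (lift ord0 i) = c *: y.
  rewrite /y scaler_sumr; apply: eq_bigr => i _.
  by rewrite scalerA mulrC divfK// gt_eqF.
have -> : \sum_(i < n) l (lift ord0 i) * f (p (lift ord0 i)) =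
    c * \sum_(i < n) (l (lift ord0 i) / c) * f (p (lift ord0 i)).
  rewrite mulr_sumr; apply: eq_bigr => i _.
  by rewrite mulrA [c * _]mulrC divfK// gt_eqF.
have -> : l ord0 = 1 - c by rewrite /c opprB addrC subrK.
have c01 : 0 <= c <= 1 by rewrite c1 ltW.
apply: le_trans (cf Kp Ky c01) _.
by rewrite lerD2l ler_pM2l//; exact: IH.
Qed.
End convexity.

(** * The cone over J in coordinates [lam] *)

Section simplex_cone.
Context {R : realType} (d : nat).
Variables (v : 'I_d.+1 -> 'rV[R]_d).
Implicit Types lam : 'rV[R]_d.+1.

Definition vert_mx : 'M[R]_d.+1 := \matrix_(j < d.+1) consr (1, v j).

Lemma vert_mx0 j : vert_mx j ord0 = 1.
Proof. by rewrite mxE consr0. Qed.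

Lemma vert_mxS j k : vert_mx j (lift ord0 k) = v j 0 k.
Proof. by rewrite mxE consrS. Qed.

Lemma mulmx_vert lam :
  lam *m vert_mx = consr (\sum_j lam 0 j, \sum_j lam 0 j *: v j).
Proof.
apply/rowP => i; rewrite mxE; case: (unliftP ord0 i) => [k ->|->].
  by rewrite consrS summxE; apply: eq_bigr => j _; rewrite vert_mxS mxE.
by rewrite consr0; apply: eq_bigr => j _; rewrite vert_mx0 mulr1.
Qed.

(** [Vmat v] is the transpose of [vert_mx] with the row of ones moved from top to bottom, which
    changes the determinant by a sign at most. *)
Lemma normr_det_vert_mx : `|\det vert_mx| = `|\det (Vmat v)|.
Proof.
have -> : Vmat v = row_perm (lift_perm ord_max ord0 1%g) vert_mx^T.
  apply/matrixP => i j; rewrite mxE [RHS]mxE [RHS]mxE.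
  case: (unliftP ord_max i) => [k ->|->].
    by rewrite lift_perm_lift perm1 vert_mxS.
  by rewrite lift_perm_id vert_mx0.
by rewrite row_permE det_mulmx det_perm det_tr normrM normr_sign mul1r.
Qed.

(** Subtracting the row of [v ord0] from the others leaves a block-triangular matrix whose lower
    block has the edge vectors as rows, that is, the transpose of [Bmat v]. *)
Lemma vert_mx_unit : Bmat v \in unitmx -> vert_mx \in unitmx.
Proof.
move=> uB.
have uL : (block_mx 1%:M 0 (const_mx 1) 1%:M : 'M[R]_(1 + d)) \in unitmx.
  by rewrite unitmxE det_lblock !det1 mul1r unitr1.
have uU : (block_mx 1%:M (v ord0) 0 (Bmat v)^T : 'M[R]_(1 + d)) \in unitmx.
  by rewrite unitmxE det_ublock det1 mul1r det_tr -unitmxE.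
have -> : vert_mx = (block_mx 1%:M 0 (const_mx 1) 1%:M : 'M[R]_(1 + d)) *m
   block_mx 1%:M (v ord0) 0 (Bmat v)^T.
  rewrite mulmx_block !mul1mx !mul0mx !mulmx1 !addr0.
  have l0 : lshift d (0 : 'I_1) = ord0 by apply: val_inj.
  have lS (k : 'I_d) : rshift 1 k = lift ord0 k by apply: val_inj.
  apply/matrixP => i j.
  case: (unliftP ord0 i) => [k ->|->]; case: (unliftP ord0 j) => [l ->|->];
    rewrite ?vert_mx0 ?vert_mxS -?lS -?l0.
  - apply: etrans (esym (block_mxEdr _ _ _ _ _ _)).
    by rewrite !mxE big_ord1 !mxE lS l0 mul1r [RHS]addrC subrK.
  - by apply: etrans (esym (block_mxEdl _ _ _ _ _ _)); rewrite mxE.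
  - by apply: etrans (esym (block_mxEur _ _ _ _ _ _)); rewrite l0.
  - by apply: etrans (esym (block_mxEul _ _ _ _ _ _)); rewrite mxE eqxx.
rewrite unitmx_mul; apply/andP; split; [exact: uL|exact: uU].
Qed.

(** A convex combination in [convhull] may list a vertex repeatedly; the weights belonging to the
    same vertex are added up. *)
Lemma simplexP x : simplex v x <-> exists2 l : 'I_d.+1 -> R,
  (forall j, 0 <= l j) /\ \sum_j l j = 1 & x = \sum_j l j *: v j.
Proof.
split=> [[m [p [l [vp l0 l1 ->]]]]|[l [l0 l1] ->]]; last first.
  by exists d.+1, v, l; split.
have /choice[s hs] : forall i, exists j, v j = p i.
  by move=> i; case: (vp i) => j _ <-; exists j.
exists (fun j => \sum_(i | s i == j) l i); first split.
- by move=> j; exact: sumr_ge0.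
- by rewrite -l1 [RHS](partition_big s predT).
rewrite (partition_big s predT)//=; apply: eq_bigr => j _.
by rewrite scaler_suml; apply: eq_bigr => i /eqP <-; rewrite hs.
Qed.

Lemma simplex_vertex j : simplex v (v j).
Proof.
exists 1%N, (fun=> v j), (fun=> 1); split => [i|//||].
- by exists j.
- by rewrite big_ord1.
- by rewrite big_ord1 scale1r.
Qed.

Hypothesis uB : Bmat v \in unitmx.

(** Defined through the coordinates [lam], which makes measurability immediate; [simplex_coneP]
    gives the geometric description. *)
Definition simplex_cone : set 'rV[R]_d.+1 :=
  [set p | std_simplex 1 (p *m invmx vert_mx)].

Lemma simplex_cone_mul lam : simplex_cone (lam *m vert_mx) <-> std_simplex 1 lam.
Proof. by rewrite /simplex_cone /= mulmxK//; exact: vert_mx_unit. Qed.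

Lemma measurable_simplex_cone : measurable simplex_cone.
Proof.
rewrite -[X in measurable X]setTI; apply: measurable_mulmx => //.
exact: measurable_std_simplex.
Qed.

Lemma simplex_coneP z x :
  simplex_cone (consr (z, x)) <-> dil z (simplex v) x /\ 0 <= z <= 1.
Proof.
split=> [|[[_ /simplexP[l [l0 l1] ->] ->] /andP[z0 z1]]].
  have := mulmxKV (vert_mx_unit uB) (consr (z, x)).
  rewrite /simplex_cone /=; set lam := _ *m invmx _.
  rewrite mulmx_vert => e [lam0 lam1].
  have := consrK (z, x); rewrite -e consrK => -[ez ex].
  have z0 : 0 <= z by rewrite -ez; apply: sumr_ge0.
  split; last by rewrite z0 -ez.
  (* At the apex all coordinates vanish, so x = 0 and any vertex is a witness; elsewhere division by
     z gives barycentric coordinates. *)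
  have [zE|zN] := eqVneq z 0.
    exists (v ord0); first exact: simplex_vertex.
    rewrite zE scale0r -ex big1// => j _.
    have /psumr_eq0P h : \sum_j lam 0 j = 0 by rewrite ez.
    by rewrite h ?scale0r// => i _; exact: lam0.
  exists (\sum_j (lam 0 j / z) *: v j).
    apply/simplexP; exists (fun j => lam 0 j / z) => //; split.
      by move=> j; rewrite divr_ge0.
    by rewrite -mulr_suml ez divff.
  rewrite -ex scaler_sumr; apply: eq_bigr => j _.
  by rewrite scalerA mulrC divfK.
have -> : consr (z, z *: (\sum_j l j *: v j)) = (\row_j (z * l j)) *m vert_mx.
  rewrite mulmx_vert; congr (consr (_, _)).
    by under eq_bigr do rewrite mxE; rewrite -mulr_sumr l1 mulr1.
  by rewrite scaler_sumr; apply: eq_bigr => j _; rewrite mxE scalerA.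
apply/simplex_cone_mul; split.
  by move=> i; rewrite mxE mulr_ge0.
by under eq_bigr do rewrite mxE; rewrite -mulr_sumr l1 mulr1.
Qed.

(** x - z v_0 is [Bmat v] applied to the coordinates of [lam] other than the first, so the inverse
    matrix recovers these; the term f(v_0) z then cancels the subtractions in [wvec]. *)
Lemma muhom_vert (f : 'rV[R]_d -> R) lam :
  muhom v f (\sum_j lam 0 j *: v j) (\sum_j lam 0 j) = \sum_j lam 0 j * f (v j).
Proof.
rewrite /muhom.
have -> : (\sum_j lam 0 j *: v j - (\sum_j lam 0 j) *: v ord0)^T =
    Bmat v *m (\row_j lam 0 (lift ord0 j))^T.
  apply/colP => i; rewrite !mxE !summxE !big_ord_recl/= !mxE.
  rewrite mulrDl opprD addrACA subrr add0r mulr_suml -sumrB.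
  by apply: eq_bigr => j _; rewrite !mxE mulrBl mulrC [v ord0 0 i * _]mulrC.
rewrite -mulmxA mulKmx// mxE [in RHS]big_ord_recl [in X in _ + X]big_ord_recl.
rewrite mulrDr addrCA; congr (_ + _); first by rewrite mulrC.
rewrite mulr_sumr -big_split/=; apply: eq_bigr => j _.
by rewrite !mxE; ring.
Qed.

Lemma simplex_cone_bounded : exists C : R, forall p, simplex_cone p -> rVbox C p.
Proof.
exists (\sum_i \sum_j `|vert_mx j i|) => p.
rewrite -[p](mulmxKV (vert_mx_unit uB)); set lam := _ *m invmx _.
move=> /simplex_cone_mul[lam0 lam1] i.
apply: (@le_trans _ _ (\sum_j `|vert_mx j i|)); last first.
  by rewrite [leRHS](bigD1 i)//= lerDl; apply: sumr_ge0 => k _; exact: sumr_ge0.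
rewrite mxE (le_trans (ler_norm_sum _ _ _))//; apply: ler_sum => j _.
rewrite normrM ger0_norm ?lam0// ler_piMl//; apply: le_trans lam1.
by rewrite (bigD1 j)//= lerDl; apply: sumr_ge0.
Qed.

Lemma simplex_coneE p : simplex_cone p ->
  exists2 lam, std_simplex 1 lam & p = lam *m vert_mx.
Proof.
by move=> Cp; exists (p *m invmx vert_mx) => //; rewrite mulmxKV//; exact: vert_mx_unit.
Qed.

End simplex_cone.

Lemma box_bounded_indic (R : realType) n (A : set 'rV[R]_n) (g : 'rV[R]_n -> R) (K C : R) :
  measurable_fun setT (fun x => g x * \1_A x) ->
  (forall x, A x -> `|g x| <= K) -> A `<=` rVbox C ->
  box_bounded (fun x => g x * \1_A x).
Proof.
move=> mg gK AC; split=> //; exists (`|K| + `|C|) => x; rewrite indicE.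
have [Ax|nAx] := pselect (A x); last first.
  by rewrite memNset// mulr0 normr0 eqxx; split=> //; rewrite addr_ge0.
rewrite mem_set// mulr1; split=> [|_ i].
  by rewrite (le_trans (gK _ Ax))// (le_trans (ler_norm K))// lerDl.
by rewrite (le_trans (AC _ Ax i))// (le_trans (ler_norm C))// lerDr.
Qed.

Lemma std_simplex_coord_le (R : realType) n (s : R) (x : 'rV[R]_n) i :
  std_simplex s x -> `|x 0 i| <= s.
Proof.
move=> [x0 xs]; rewrite ger0_norm//; apply: le_trans xs.
by rewrite (bigD1 i)//= lerDl; exact: sumr_ge0.
Qed.

(** * Bounds and measurability of the integrands on the cone *)

Section naive_relaxation.
Context {R : realType} (d : nat).
Variables (v : 'I_d.+1 -> 'rV[R]_d) (f : 'rV[R]_d -> R).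
Local Notation K := (convhull (simplex v `|` [set 0])).
Local Notation mR := (measurableTypeR R).
Local Notation leb := (@lebesgue_measure R).
Local Notation M := (vert_mx v).
Local Notation C := (simplex_cone v).
Hypotheses (uB : Bmat v \in unitmx) (f0 : f 0 = 0)
  (cont_f : {within K, continuous f}) (conv_f : convex_on K f).

Let S0 : (simplex v `|` [set 0]) 0. Proof. by right. Qed.
Let Sv j : (simplex v `|` [set 0]) (v j). Proof. by left; exact: simplex_vertex. Qed.

Lemma simplex_cone_hull p : C p -> K (unconsr p).2.
Proof.
move=> /(simplex_coneE uB)[lam [l0 l1] ->]; rewrite mulmx_vert consrK/=.
exact: convhull_subconvex.
Qed.

Lemma fun_le_cone lam : std_simplex 1 lam ->
  f (\sum_j lam 0 j *: v j) <= \sum_j lam 0 j * f (v j).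
Proof. by move=> [l0 l1]; exact: (convex_on_subconvex S0 f0 conv_f Sv l0 l1). Qed.

Lemma cone_sum_bounded lam : std_simplex 1 lam ->
  `|\sum_j lam 0 j * f (v j)| <= \sum_j `|f (v j)|.
Proof.
move=> slam; rewrite (le_trans (ler_norm_sum _ _ _))//; apply: ler_sum => j _.
by rewrite normrM ler_piMl// std_simplex_coord_le.
Qed.

(* The barycenter c of the cone lies on the segment from any x in the cone to
   some y in the cone, so f x is bounded below in terms of f c and sup f. *)
Lemma fun_bounded_cone : exists B : R, forall p, C p -> `|f (unconsr p).2| <= B.
Proof.
have [m mE] : exists m : R, m = d.+1%:R by exists d.+1%:R.
have m0 : 0 < m by rewrite mE ltr0n.
pose B0 := \sum_j `|f (v j)|.
pose c := \sum_j (m + 1)^-1 *: v j.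
have B00 : 0 <= B0 by exact: sumr_ge0.
(* [B0] bounds f above; the lower bound (m + 1) f(c) - m [B0] comes from (m + 1) f(c) <= m f(y) +
   f(x). *)
exists (B0 + `|m * B0 - (m + 1) * f c|) => p /(simplex_coneE uB)[lam slam ->].
rewrite mulmx_vert consrK/=; set x := \sum_j _.
have fx : f x <= B0.
  apply: le_trans (fun_le_cone slam) _.
  by apply: le_trans (ler_norm _) _; exact: cone_sum_bounded.
(* Chosen so that m [lam'] + [lam] has all entries 1, which puts c on the segment from y to x;
   dividing by m = d + 1 keeps the total weight at most 1. *)
pose lam' : 'rV[R]_d.+1 := \row_j ((1 - lam 0 j) / m).
have slam' : std_simplex 1 lam'.
  split=> [j|].
    rewrite mxE divr_ge0 ?(ltW m0)// subr_ge0 (le_trans (ler_norm _))//.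
    exact: std_simplex_coord_le.
  under eq_bigr do rewrite mxE.
  rewrite -mulr_suml sumrB sumr_const card_ord ler_pdivrMr// mul1r -mE.
  by rewrite gerBl; apply: sumr_ge0 => j _; case: slam.
pose y := \sum_j lam' 0 j *: v j.
have fy : f y <= B0.
  apply: le_trans (fun_le_cone slam') _.
  by apply: le_trans (ler_norm _) _; exact: cone_sum_bounded.
have Kx : K x by apply: convhull_subconvex => //; case: slam.
have Ky : K y by apply: convhull_subconvex => //; case: slam'.
have t01 : 0 <= (m + 1)^-1 <= 1.
  by rewrite invr_ge0 ltW ?addr_gt0//= invf_le1 ?addr_gt0// lerDr ltW.
have m1 : m + 1 != 0 by rewrite gt_eqF// addr_gt0.
have := conv_f Ky Kx t01.
have -> : (1 - (m + 1)^-1) *: y + (m + 1)^-1 *: x = c.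
  rewrite /y /x /c !scaler_sumr -big_split/=; apply: eq_bigr => j _.
  rewrite !scalerA -scalerDl mxE; congr (_ *: _); field.
  by rewrite m1 gt_eqF.
move=> fc.
have {}fc : (m + 1) * f c <= m * f y + f x.
  have := ler_wpM2l (ltW (addr_gt0 m0 ltr01)) fc.
  by rewrite (_ : (m + 1) * (_ + _) = m * f y + f x)//; field.
have fyB : m * f y <= m * B0 by rewrite ler_pM2l.
rewrite ler_norml.
have := ler_norm (m * B0 - (m + 1) * f c); have := normr_ge0 (m * B0 - (m + 1) * f c).
by set N := `|_| => N0 hN; apply/andP; split; lra.
Qed.

Definition fcone (p : 'rV[R]_d.+1) : R := f (unconsr p).2 * \1_C p.
(** Written in the coordinates [lam], ready for the change of variables; [muhom_cone] identifies it
    with [muhom] on the cone. *)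
Definition mucone (p : 'rV[R]_d.+1) : R :=
  (\sum_j (p *m invmx M) 0 j * f (v j)) * \1_C p.

(** Continuity is relative to [K], so the preimage of an open interval is only the trace on [K] of
    an open set V. Points of the cone project into [K], hence inside the cone it is the preimage of
    V itself. *)
Lemma measurable_fcone : measurable_fun setT fcone.
Proof.
have mC := measurable_simplex_cone v.
have mx : measurable_fun setT (fun p : 'rV[R]_d.+1 => (unconsr p).2).
  exact: (measurableT_comp measurable_snd (@measurable_unconsr R d)).
have mf : measurable_fun C (fun p => f (unconsr p).2).
  apply: (measurability _ (RGenOpens.measurableE R)) => _ [_ [a [b ->] <-]].
  have /continuousP/(_ _ (interval_open (a := BRight a) (b := BLeft b) isT isT)) := cont_f.
  move=> /open_subspaceP[V oV VE].
  have -> : C `&` (fun p => f (unconsr p).2) @^-1` `]a, b[%classic =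
      C `&` ((fun p => (unconsr p).2) @^-1` V).
    apply/seteqP; split=> p [Cp h]; split=> //.
      have : (f @^-1` `]a, b[%classic `&` K) (unconsr p).2.
        by split=> //; exact: simplex_cone_hull.
      by rewrite -VE => -[].
    have : (V `&` K) (unconsr p).2 by split=> //; exact: simplex_cone_hull.
    by rewrite VE => -[].
  apply: measurableI => //; rewrite -[X in measurable X]setTI; apply: mx => //.
  exact: open_measurable_rV.
rewrite (_ : fcone = (fun p => f (unconsr p).2) \_ C).
  by apply/(measurable_restrictT _ _).1.
by apply/funext => p; rewrite patchE /fcone indicE; case: (p \in C); rewrite ?mulr1 ?mulr0.
Qed.

Lemma measurable_mucone : measurable_fun setT mucone.
Proof.
apply: measurable_funM; last exact: measurable_indic (measurable_simplex_cone v).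
apply: measurable_sum => j; apply: measurable_funM => //.
exact: (measurableT_comp (measurable_coord j) (measurable_mulmx (invmx M))).
Qed.

Lemma box_bounded_fcone : box_bounded fcone.
Proof.
have [B1 hB1] := fun_bounded_cone; have [B2 hB2] := simplex_cone_bounded uB.
exact: box_bounded_indic measurable_fcone hB1 hB2.
Qed.

Lemma box_bounded_mucone : box_bounded mucone.
Proof.
have [B2 hB2] := simplex_cone_bounded uB.
apply: box_bounded_indic measurable_mucone _ hB2 => p Cp.
exact: cone_sum_bounded.
Qed.

Lemma fcone_le_mucone p : fcone p <= mucone p.
Proof.
rewrite /fcone /mucone indicE.
have [Cp|nCp] := pselect (C p); last by rewrite memNset// !mulr0.
rewrite mem_set// !mulr1; have [lam slam ->] := simplex_coneE uB Cp.
rewrite mulmxK ?vert_mx_unit// mulmx_vert consrK/=.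
exact: fun_le_cone.
Qed.

Lemma muhom_cone z x : C (consr (z, x)) -> muhom v f x z = mucone (consr (z, x)).
Proof.
move=> Cp; rewrite /mucone indicE mem_set// mulr1.
have [lam slam e] := simplex_coneE uB Cp.
rewrite e mulmxK ?vert_mx_unit// -muhom_vert//.
by move: e; rewrite mulmx_vert => /(can_inj (@consrK R d)) [-> ->].
Qed.

End naive_relaxation.

(** * The volume *)

Section naive_relaxation_volume.
Context {R : realType} (d : nat).
Variables (v : 'I_d.+1 -> 'rV[R]_d) (f : 'rV[R]_d -> R).
Local Notation K := (convhull (simplex v `|` [set 0])).
Local Notation mR := (measurableTypeR R).
Local Notation leb := (@lebesgue_measure R).
Local Notation M := (vert_mx v).
Local Notation C := (simplex_cone v).
Local Notation fcone := (fcone v f).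
Local Notation mucone := (mucone v f).
Hypotheses (uB : Bmat v \in unitmx) (f0 : f 0 = 0)
  (cont_f : {within K, continuous f}) (conv_f : convex_on K f).
Local Open Scope ereal_scope.

(** The pair (y, z) appears in the nested form that [iint] produces, ending in the empty row vector
    0. *)
Lemma P0_cone (x : 'rV[R]_d) (y z : R) :
  P0 v f (row_mx x (consr (y, consr (z, 0%R)))) <->
  C (consr (z, x)) /\ (fcone (consr (z, x)) <= y <= mucone (consr (z, x)))%R.
Proof.
rewrite /P0 /= row_mxKl row_mxKr.
have -> : ord_z = lift ord0 ord0 by apply: val_inj.
rewrite consrS consr0/= consr0/=.
split=> [[h1 h2 h3 h4]|[Cp /andP[h1 h2]]].
  have Cp : C (consr (z, x)) by apply/simplex_coneP.
  by rewrite -muhom_cone// h1 /fcone indicE mem_set// mulr1 consrK/= h2.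
have [h3 h4] := (simplex_coneP uB z x).1 Cp.
by split=> //; [rewrite muhom_cone|move: h1; rewrite /fcone indicE mem_set// mulr1 consrK].
Qed.

Let gap (p : 'rV[R]_d.+1) : \bar R := (mucone p - fcone p)%:E.

Let mgap : measurable_fun setT gap.
Proof.
apply/measurable_EFinP; apply: measurable_funB; first exact: measurable_mucone.
exact: measurable_fcone.
Qed.

Let gap_ge0 p : 0 <= gap p.
Proof. by rewrite lee_fin subr_ge0; exact: fcone_le_mucone. Qed.

Let mphi : measurable_fun setT (fun q : 'rV[R]_d * mR => consr (q.2, q.1)).
Proof.
apply: (measurableT_comp (@measurable_consr R d)).
by apply: measurable_fun_pair; [exact: measurable_snd|exact: measurable_fst].
Qed.

(** After exchanging y and z, the inner integral is the length of the interval from [fcone] to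
    [mucone], or 0 off the cone; the exchange is why the fiber [W] must be shown measurable. *)
Lemma integral_P0_fiber (x : 'rV[R]_d) :
  \int[leb]_y \int[leb]_z (\1_(P0 v f) (row_mx x (consr (y, consr (z, 0%R)))))%:E =
  \int[leb]_z gap (consr (z, x)).
Proof.
pose W : set (mR * mR) :=
  [set q | P0 v f (row_mx x (consr (q.1, consr (q.2, 0%R))))].
have mx : measurable_fun setT (fun z : mR => consr (z, x)).
  exact: (measurableT_comp (@measurable_consr R d) (measurable_pair2 x)).
have mz : measurable_fun setT (fun q : mR * mR => consr (q.2, x)).
  exact: (measurableT_comp mx measurable_snd).
have mW : measurable W.
  have -> : W = ((fun q : mR * mR => consr (q.2, x)) @^-1` C) `&`
     (((fun q : mR * mR => q.1 - fcone (consr (q.2, x)))%R @^-1` `[0%R, +oo[) `&`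
      ((fun q : mR * mR => mucone (consr (q.2, x)) - q.1)%R @^-1` `[0%R, +oo[)).
    apply/seteqP; split=> -[y z].
      move=> /P0_cone[Cp /andP[h1 h2]]; split=> //.
      by split; rewrite /= in_itv/= andbT subr_ge0.
    move=> [Cp [/=]]; rewrite !in_itv/= !andbT !subr_ge0 => h1 h2.
    by apply/P0_cone; split=> //; rewrite h1 h2.
  apply: measurableI.
    by rewrite -[X in measurable X]setTI; apply: mz => //; exact: measurable_simplex_cone.
  apply: measurableI.
    have m1 : measurable_fun setT (fun q : mR * mR => (q.1 - fcone (consr (q.2, x)))%R).
      apply: measurable_funB; first exact: measurable_fst.
      by apply: (measurableT_comp _ mz); exact: measurable_fcone.
    by rewrite -[X in measurable X]setTI; apply: m1 => //; exact: measurable_itv.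
  have m1 : measurable_fun setT (fun q : mR * mR => (mucone (consr (q.2, x)) - q.1)%R).
    apply: measurable_funB; last exact: measurable_fst.
    by apply: (measurableT_comp _ mz); exact: measurable_mucone.
  by rewrite -[X in measurable X]setTI; apply: m1 => //; exact: measurable_itv.
have mW1 : measurable_fun setT (fun q : mR * mR => (\1_W q : R)%:E).
  by apply/measurable_EFinP; exact: measurable_indic.
transitivity (\int[leb]_y \int[leb]_z (\1_W (y, z) : R)%:E).
  by apply: eq_integral => y _; apply: eq_integral => z _; congr EFin.
rewrite (fubini_tonelli _ mW1)//.
apply: eq_integral => z _.
transitivity (\int[leb]_y (\1_[set y | W (y, z)] y : R)%:E).
  by apply: eq_integral => y _; congr EFin.
have [Cp|nCp] := pselect (C (consr (z, x))).
  have -> : [set y | W (y, z)] = `[fcone (consr (z, x)), mucone (consr (z, x))]%classic.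
    apply/seteqP; split=> y /=; rewrite in_itv/=; first by move=> /P0_cone[].
    by move=> h; apply/P0_cone.
  have mi : measurable (`[fcone (consr (z, x)), mucone (consr (z, x))]%classic : set mR).
    exact: measurable_itv.
  rewrite integral_indic// setIT.
  apply: etrans (lebesgue_measure_itv `[fcone (consr (z, x)), mucone (consr (z, x))]) _ => /=.
  rewrite lte_fin -EFinB /gap.
  (* In the degenerate case the length is 0, and the two endpoints coincide. *)
  case: ltP => // h; congr EFin; apply/esym/eqP; rewrite subr_eq0 eq_le h.
  exact: fcone_le_mucone.
have -> : [set y | W (y, z)] = set0.
  by apply/seteqP; split=> y //= /P0_cone[].
rewrite /gap /fcone /mucone !indicE (memNset nCp) !mulr0 subrr.
by under eq_integral do rewrite indicE in_set0; rewrite integral0.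
Qed.

Lemma voln_P0 : voln (P0 v f) =
  \int[rVleb d.+1]_p (mucone p)%:E - \int[rVleb d.+1]_p (fcone p)%:E.
Proof.
have mg := measurableT_comp mgap mphi.
rewrite /voln iint_row_mx.
transitivity (iint (fun x : 'rV[R]_d => \int[leb]_z gap (consr (z, x)))).
  by apply: eq_iint => x; rewrite -integral_P0_fiber.
rewrite ge0_iintE; last 2 first.
- exact: (measurable_fun_fubini_tonelli_F (m2 := leb) _ mg (fun _ => gap_ge0 _)).
- by move=> x; exact: integral_ge0.
(* The cone lists z before x, so these are exchanged before being merged into one vector. *)
rewrite (fubini_tonelli _ mg (fun _ => gap_ge0 _))/=.
rewrite -ge0_integral_rVleb_consr//.
rewrite -integralB_EFin//.
- by apply: box_bounded_integrable; exact: box_bounded_mucone.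
- by apply: box_bounded_integrable; exact: box_bounded_fcone.
Qed.

Lemma integral_mucone : \int[rVleb d.+1]_p (mucone p)%:E =
  ((((d + 2)`!)%:R^-1 * `|\det (Vmat v)| * \sum_(j < d.+1) f (v j))%R)%:E.
Proof.
have uM := vert_mx_unit uB.
have iG : (rVleb d.+1).-integrable setT (EFin \o mucone).
  by apply: box_bounded_integrable; exact: box_bounded_mucone.
have dM : (`|\det M| != 0)%R by rewrite normr_eq0 -unitfE -unitmxE.
have -> : \int[rVleb d.+1]_p (mucone p)%:E =
    `|\det M|%:E * \int[rVleb d.+1]_p (mucone (p *m M))%:E.
  by rewrite (integral_rVleb_mulmx uM iG) muleA -EFinM divff// mul1e.
pose T (j : 'I_d.+1) (lam : 'rV[R]_d.+1) : R := (lam 0%R j * \1_(std_simplex 1) lam)%R.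
have bT j : box_bounded (T j).
  apply: (@box_bounded_indic _ _ _ _ 1 1).
  - apply: measurable_funM; first exact: measurable_coord.
    by apply: measurable_indic; exact: measurable_std_simplex.
  - by move=> x sx; exact: std_simplex_coord_le.
  - by move=> x sx i; exact: std_simplex_coord_le.
have iT j : (rVleb d.+1).-integrable setT (EFin \o T j) by exact: box_bounded_integrable.
transitivity (`|\det M|%:E * \int[rVleb d.+1]_lam \sum_j ((f (v j))%:E * (T j lam)%:E)).
  congr (_ * _); apply: eq_integral => lam _.
  under eq_bigr do rewrite -EFinM.
  rewrite sumEFin; congr EFin; rewrite /mucone mulmxK// mulr_suml; apply: eq_bigr => j _.
  rewrite /T mulrCA -mulrA; congr (_ * (_ * _))%R.
  rewrite !indicE; congr (nat_of_bool _)%:R.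
  apply/idP/idP; rewrite !inE; first by move=> /(simplex_cone_mul uB).
  by move=> h; apply/(simplex_cone_mul uB).
rewrite integral_sum//; last by move=> j; apply: integrableZl => //; exact: iT.
under eq_bigr => j _.
  rewrite (integralZl measurableT (iT j)).
  (* There are d + 1 coordinates and the integrand has degree one, hence (d + 2)!. *)
  rewrite -(box_bounded_iintE (bT j)) iint_std_simplex_coord// expr1n -EFinM.
  over.
rewrite sumEFin -EFinM; congr EFin.
rewrite normr_det_vert_mx addn2 -mulr_suml; ring.
Qed.

Lemma fcone_zero z x : (~~ (0 <= z <= 1) \/ z = 0)%R -> fcone (consr (z, x)) = 0%R.
Proof.
rewrite /fcone indicE consrK/=; have [Cp|nCp] := pselect (C (consr (z, x))); last first.
  by rewrite memNset// mulr0.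
have [[y Jy ->] z01] := (simplex_coneP uB z x).1 Cp.
by rewrite z01 => -[//|->]; rewrite scale0r f0 mul0r.
Qed.

(** The slice of the cone at height z is z.J, and the scalar matrix z has determinant z^d. *)
Lemma intn_fcone z : (0 <= z <= 1)%R ->
  iint (fun x => (fcone (consr (z, x)))%:E) =
  (z ^+ d)%:E * intn (simplex v) (fun x => f (z *: x)).
Proof.
move=> z01.
(* The substitution is singular at z = 0. Both integrals vanish there because f 0 = 0, which also
   covers d = 0, where z^d = 1. *)
have [->|zN] := eqVneq z 0%R.
  rewrite (@eq_iint _ _ _ (fun=> 0)); last by move=> x; rewrite fcone_zero//; right.
  rewrite /intn (@eq_iint _ _ (fun x => ((fun x0 => f (0 *: x0)) \_ (simplex v) x)%:E)
    (fun=> 0)); last first.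
    by move=> x; rewrite patchE scale0r f0; case: ifP.
  by rewrite !iint0 mule0.
have bF : box_bounded (fun x => fcone (consr (z, x))).
  by apply: box_bounded_slice; exact: box_bounded_fcone.
have uz : (z%:M : 'M[R]_d) \in unitmx.
  by rewrite unitmxE det_scalar unitfE expf_neq0.
have zd : (`|z ^+ d| != 0)%R by rewrite normr_eq0 expf_neq0.
have mulz (x : 'rV[R]_d) : x *m z%:M = z *: x by rewrite mul_mx_scalar.
have [B1 hB1] := fun_bounded_cone uB f0 conv_f; have [B2 hB2] := simplex_cone_bounded uB.
have JC x : simplex v x -> C (consr (1%R, x)).
  move=> Jx; apply/(simplex_coneP uB); split; last by rewrite ler01 lexx.
  by exists x => //; rewrite scale1r.
have JzC x : C (consr (z, z *: x)) <-> simplex v x.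
  rewrite (simplex_coneP uB); split=> [[[y Jy e] _]|Jx]; last by split=> //; exists x.
  by move: e => /(scalerI zN) ->.
have FE x : fcone (consr (z, x *m z%:M)) = (f (z *: x) * \1_(simplex v) x)%R.
  rewrite mulz /fcone consrK/=; congr (_ * _)%R; rewrite !indicE; congr (nat_of_bool _)%:R.
  by apply/idP/idP; rewrite !inE => /JzC.
(* The values are bounded since (z, z x) lies in the cone, and the support since (1, x) does. *)
have bJ : box_bounded (fun x => f (z *: x) * \1_(simplex v) x)%R.
  apply: (@box_bounded_indic _ _ _ _ B1 B2).
  - rewrite (_ : (fun x => _) = (fun x => fcone (consr (z, x))) \o (fun x => x *m z%:M)).
      by apply: measurableT_comp; [case: bF|exact: measurable_mulmx].
    by apply/funext => x /=; rewrite FE.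
  - by move=> x /JzC /hB1; rewrite consrK.
  - by move=> x /JC /hB2 h i; have := h (lift ord0 i); rewrite consrS.
rewrite /intn (@eq_iint _ _ (fun x => ((fun x0 => f (z *: x0)) \_ (simplex v) x)%:E)
    (EFin \o (fun x => f (z *: x) * \1_(simplex v) x)%R)); last first.
  by move=> x; rewrite /= patchE indicE; case: (x \in _); rewrite ?mulr1 ?mulr0.
rewrite (box_bounded_iintE bJ) (box_bounded_iintE bF).
have := integral_rVleb_mulmx uz (box_bounded_integrable bF).
rewrite /= det_scalar; under eq_integral do rewrite FE.
move=> ->; rewrite muleA -EFinM ger0_norm ?exprn_ge0//; last by case/andP : z01.
by rewrite divff ?mul1e// expf_neq0.
Qed.

Lemma integral_fcone : \int[rVleb d.+1]_p (fcone p)%:E =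
  \int[leb]_(z in `[0%R, 1%R]%classic)
    ((z ^+ d)%:E * intn (simplex v) (fun x => f (z *: x))).
Proof.
have bF : box_bounded fcone by exact: box_bounded_fcone.
rewrite -(box_bounded_iintE bF) [RHS]integral_mkcond.
apply: eq_integral => z _; rewrite patchE; case: ifPn.
  by rewrite inE/= in_itv/= => z01; rewrite -intn_fcone.
rewrite notin_setE/= in_itv/= => /negP z01.
rewrite -[RHS](@iint0 R d); apply: eq_iint => x.
by rewrite -[row_mx _ _]/(consr (z, x)) /= fcone_zero//; left.
Qed.

End naive_relaxation_volume.

Theorem theorem2 (R : realType) (d : nat) (v : 'I_d.+1 -> 'rV[R]_d)
  (f : 'rV[R]_d -> R) :
  Bmat v \in unitmx ->
  (forall x, simplex v x -> (forall i, 0 <= x 0 i) /\ x != 0) ->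
  f 0 = 0 ->
  {within convhull (simplex v `|` [set 0]), continuous f} ->
  convex_on (convhull (simplex v `|` [set 0])) f ->
  voln (P0 v f) =
    ((((d + 2)`!)%:R^-1 * `|\det (Vmat v)| * \sum_(j < d.+1) f (v j))%:E
     - \int[@lebesgue_measure R]_(z in `[0%R, 1%R]%classic)
          ((z ^+ d)%:E * intn (simplex v) (fun x => f (z *: x))))%E.
Proof.
move=> uB _ f0 cont_f conv_f.
by rewrite voln_P0// integral_mucone// integral_fcone.
Qed.
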